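(* Suppose $\mathcal{B}$ is a semi-normalized $M$-bounded basis of a quasi-Banach space $\mathbb{X}$. Then $\mathcal{B}$ is greedy if and only if it is unconditional and almost greedy, with $$C_{ag}\le C_g\le C_{ag}K_{su}.$$ Moreover, if the quasi-norm is continuous, $K_{su}\le C_g$.
   Context: The scalar field is $\mathbb{R}$ or $\mathbb{C}$. A quasi-norm satisfies the axioms of a norm except that the triangle inequality is replaced by $\Vert f+g\Vert\le\kappa(\Vert f\Vert+\Vert g\Vert)$ for some constant $\kappa\ge1$; a quasi-Banach space is a vector space complete for the topology of a quasi-norm. A basis of $\mathbb{X}$ is a sequence $\mathcal{B}=(\mathbf{x}_n)_{n=1}^\infty$ whose closed linear span is $\mathbb{X}$ and for which there is a (unique) sequence $(\mathbf{x}_n^* )_{n=1}^\infty$ in $\mathbb{X}^*$ with $\mathbf{x}_n^*(\mathbf{x}_k)=\delta_{k,n}$. It is $M$-bounded if $\sup_n\Vert\mathbf{x}_n\Vert\,\Vert\mathbf{x}_n^*\Vert<\infty$ and semi-normalized if $0<\inf_n\Vert\mathbf{x}_n\Vert\le\sup_n\Vert\mathbf{x}_n\Vert<\infty$. The support of $f$ is $\mathrm{supp}(f)=\{n:\mathbf{x}_n^*(f)\ne0\}$. For $A\subseteq\mathbb{N}$, $S_A$ is the linear map on the linear span of $\mathcal{B}$ with $S_A(\mathbf{x}_n)=\mathbf{x}_n$ for $n\in A$ and $S_A(\mathbf{x}_n)=0$ otherwise, extended to $\mathbb{X}$ when it is continuous; for finite $A$, $S_A(f)=\sum_{n\in A}\mathbf{x}_n^*(f)\mathbf{x}_n$.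 $\mathcal{B}$ is an unconditional basis if every $f\in\mathbb{X}$ has a unique expansion $f=\sum_{n=1}^\infty a_n\mathbf{x}_n$ with unconditional convergence; equivalently, $S_A$ is well-defined (continuous) for every $A\subseteq\mathbb{N}$ and $K_{su}:=\sup_{A\subseteq\mathbb{N}}\Vert S_A\Vert<\infty$. A set $A\subseteq\mathbb{N}$ is a greedy set of $f$ if $|\mathbf{x}_k^*(f)|\le|\mathbf{x}_n^*(f)|$ for all $n\in A$, $k\in\mathbb{N}\setminus A$. $\mathcal{B}$ is almost greedy if there is $C\ge1$ such that $\Vert f-S_A(f)\Vert\le C\Vert f-S_B(f)\Vert$ whenever $A$ is a finite greedy set of $f\in\mathbb{X}$ and $B\subseteq\mathbb{N}$ with $|B|\le|A|$; the smallest such $C$ is $C_{ag}$. $\mathcal{B}$ is greedy if there is $C\ge1$ such that $\Vert f-S_A(f)\Vert\le C\Vert f-z\Vert$ whenever $A$ is a finite greedy set of $f\in\mathbb{X}$ and $z\in\mathbb{X}$ satisfies $|\mathrm{supp}(z)|\le|A|$; the smallest such $C$ is $C_g$. *)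

(* Defs.v *)
From HB Require Import structures.
From mathcomp Require Import all_boot all_order all_algebra.
From mathcomp Require Import all_classical all_reals all_analysis.
From mathcomp Require Import complex.

Set Implicit Arguments.
Unset Strict Implicit.
Unset Printing Implicit Defensive.

Import Order.TTheory GRing.Theory Num.Theory.
Import numFieldNormedType.Exports.

Local Open Scope classical_set_scope.
Local Open Scope ring_scope.

Variant scalar_kind := RealScalars | ComplexScalars.

Definition scalars (R : realType) (k : scalar_kind) : numFieldType :=
  match k with
  | RealScalars => R
  | ComplexScalars => R[i]
  end.

(* The library norm of a numFieldType K takes its values in K; the modulus is
   the same number as an element of R. *)
Definition modulus (R : realType) (k : scalar_kind) : scalars R k -> R :=
  match k return scalars R k -> R with
  | RealScalars => fun a => `|a|
  | ComplexScalars => fun a => complex.Re `|a|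
  end.

(* The sets {g | quasi_norm (f - g) < e} need not be open when the quasi-norm
   is not continuous; they are neighbourhoods of f, and they generate the
   uniform structure. *)
HB.mixin Record PreUniformLmodule_isQuasiNormed (R : realType) (k : scalar_kind)
    X & PreUniformLmodule (scalars R k) X := {
  quasi_norm : X -> R ;
  quasi_norm_ge0 : forall f, 0 <= quasi_norm f ;
  quasi_norm_eq0 : forall f, quasi_norm f = 0 -> f = 0 ;
  quasi_normZ : forall (a : scalars R k) f,
    quasi_norm (a *: f) = modulus a * quasi_norm f ;
  quasi_normD : exists2 kappa : R, 1 <= kappa &
    forall f g, quasi_norm (f + g) <= kappa * (quasi_norm f + quasi_norm g) ;
  entourage_quasi_normE :
    entourage = entourage_ (fun f (e : R) => [set g | quasi_norm (f - g) < e])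
}.

#[short(type="quasiNormedModType")]
HB.structure Definition QuasiNormedModule (R : realType) (k : scalar_kind) :=
  {X of PreUniformLmodule (scalars R k) X
      & PreUniformLmodule_isQuasiNormed R k X}.

(* This is the axiom of the library class Complete, which cannot be inherited
   because its parent Pointed has no declared join with the algebraic classes. *)
HB.mixin Record QuasiNormedModule_isComplete (R : realType) (k : scalar_kind)
    X & QuasiNormedModule R k X := {
  cauchy_converges : forall F : set_system X,
    ProperFilter F -> cauchy F -> exists f : X, F --> f
}.

#[short(type="quasiBanachType")]
HB.structure Definition QuasiBanach (R : realType) (k : scalar_kind) :=
  {X of QuasiNormedModule R k X & QuasiNormedModule_isComplete R k X}.

Section Bases.
Context (R : realType) (k : scalar_kind) (X : quasiBanachType R k).
Local Notation K := (scalars R k).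

Definition functional_norm (phi : X -> K) : \bar R :=
  ereal_sup [set (modulus (phi f))%:E | f in [set f : X | quasi_norm f <= 1]].

Definition operator_norm (T : X -> X) : \bar R :=
  ereal_sup [set (quasi_norm (T f))%:E | f in [set f : X | quasi_norm f <= 1]].

Definition linear_span (x : nat -> X) : set X :=
  [set f | exists N (a : nat -> K), f = \sum_(n < N) a n *: x n].

(* xs is the sequence of coordinate functionals x_n^*, which is determined
   by x. *)
Definition basis_with (x : nat -> X) (xs : nat -> {scalar X}) : Prop :=
  [/\ closure (linear_span x) = setT,
      forall n, continuous (xs n : X -> K) &
      forall n j, xs n (x j) = (j == n)%:R].

Definition M_bounded (x : nat -> X) (xs : nat -> {scalar X}) : Prop :=
  (ereal_sup (range (fun n => (quasi_norm (x n))%:E * functional_norm (xs n)))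
   < +oo)%E.

Definition semi_normalized (x : nat -> X) : Prop :=
  (0 < ereal_inf (range (fun n => (quasi_norm (x n))%:E)) /\
   ereal_sup (range (fun n => (quasi_norm (x n))%:E)) < +oo)%E.

Definition supp (xs : nat -> {scalar X}) (f : X) : set nat :=
  [set n | xs n f != 0].

Definition unconditionally_sums (u : nat -> X) (f : X) : Prop :=
  forall s : nat -> nat, bijective s -> series (u \o s) @ \oo --> f.

Definition unconditional (x : nat -> X) : Prop :=
  forall f : X, exists! a : nat -> K,
    unconditionally_sums (fun n => a n *: x n) f.

(* S_A(f) for finite A (the sum is 0 if it has infinitely many nonzero terms) *)
Definition coord_proj (x : nat -> X) (xs : nat -> {scalar X})
    (A : set nat) (f : X) : X :=
  \sum_(n \in A) xs n f *: x n.

(* T is the continuous extension to X of the linear map S_A on the span *)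
Definition extends_coord_proj (x : nat -> X) (A : set nat)
    (T : {linear X -> X}) : Prop :=
  continuous T /\
  forall n, (A n -> T (x n) = x n) /\ (~ A n -> T (x n) = 0).

(* When x is a basis, at most one T extends S_A, so the infimum is over at most
   one value; it is +oo when S_A is not continuous. *)
Definition coord_proj_norm (x : nat -> X) (A : set nat) : \bar R :=
  ereal_inf [set operator_norm T | T in extends_coord_proj x A].

Definition K_su (x : nat -> X) : \bar R :=
  ereal_sup (range (coord_proj_norm x)).

Definition greedy_set (xs : nat -> {scalar X}) (f : X) (A : set nat) : Prop :=
  forall n j, A n -> ~ A j -> modulus (xs j f) <= modulus (xs n f).

Definition almost_greedy_with (x : nat -> X) (xs : nat -> {scalar X})
    (C : R) : Prop :=
  1 <= C /\
  forall (f : X) (A B : set nat),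
    finite_set A -> greedy_set xs f A -> (B #<= A)%card ->
    quasi_norm (f - coord_proj x xs A f) <=
    C * quasi_norm (f - coord_proj x xs B f).

Definition almost_greedy (x : nat -> X) (xs : nat -> {scalar X}) : Prop :=
  exists C, almost_greedy_with x xs C.

Definition C_ag (x : nat -> X) (xs : nat -> {scalar X}) : \bar R :=
  ereal_inf [set C%:E | C in almost_greedy_with x xs].

Definition greedy_with (x : nat -> X) (xs : nat -> {scalar X}) (C : R) : Prop :=
  1 <= C /\
  forall (f z : X) (A : set nat),
    finite_set A -> greedy_set xs f A -> (supp xs z #<= A)%card ->
    quasi_norm (f - coord_proj x xs A f) <= C * quasi_norm (f - z).

Definition greedy (x : nat -> X) (xs : nat -> {scalar X}) : Prop :=
  exists C, greedy_with x xs C.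

Definition C_g (x : nat -> X) (xs : nat -> {scalar X}) : \bar R :=
  ereal_inf [set C%:E | C in greedy_with x xs].

End Bases.

(* Main.v *)
(* Write P_B f for the coordinate projection of f on a finite set B, and say that
   the basis has complement bound C if |f - P_B f| <= C |f| for all B and f.
   Adding a large multiple of the indicator vector of B to f makes B a greedy
   set, so a C-greedy basis has complement bound C. Conversely, if z has finite
   support B, then f - P_B f = (f - z) - P_B (f - z), so a C-almost greedy basis
   with complement bound L is (C L)-greedy. By density of the span, a complement
   bound makes P_B f converge to f along all finite sets B, which gives
   unconditionality, and makes f - P_B f converge along the finite sets B that
   exhaust the complement of A, which gives S_A and, when the quasi-norm is
   continuous, the bound on its norm. A gliding hump shows that every unconditional basis has
   some complement bound. *)
Require Import Defs.
From HB Require Import structures.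
From mathcomp Require Import all_boot all_order all_algebra.
From mathcomp Require Import all_classical all_reals all_analysis.
From mathcomp Require Import complex lra.

Set Implicit Arguments.
Unset Strict Implicit.
Unset Printing Implicit Defensive.

Import Order.TTheory GRing.Theory Num.Theory.
Import numFieldNormedType.Exports.
Local Open Scope classical_set_scope.
Local Open Scope ring_scope.

(** * The modulus on both scalar fields *)

Section Modulus.
Context (R : realType) (k : scalar_kind).
Local Notation K := (scalars R k).

Lemma modulus_ge0 (a : K) : 0 <= modulus a.
Proof. by case: k a => [|[? ?]] /=; [exact: normr_ge0 | exact: sqrtr_ge0]. Qed.

Lemma modulus_eq0 (a : K) : modulus a = 0 -> a = 0.
Proof. by case: k a => a /=; [exact: normr0_eq0 | exact: Normc.eq0_normc]. Qed.

Lemma modulusD (a b : K) : modulus (a + b) <= modulus a + modulus b.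
Proof. by case: k a b => a b /=; [exact: ler_normD | exact: le_normcD]. Qed.

Lemma modulusN (a : K) : modulus (- a) = modulus a.
Proof. by case: k a => a /=; [exact: normrN | exact: normcN]. Qed.

Lemma modulus1 : modulus (1 : K) = 1.
Proof. by case: k => /=; [exact: normr1 | exact: Normc.normc1]. Qed.

Lemma modulus0 : modulus (0 : K) = 0.
Proof. by case: k => /=; [exact: normr0 | exact: Normc.normc0]. Qed.

Definition of_real : R -> K :=
  match k return R -> scalars R k with
  | RealScalars => id
  | ComplexScalars => fun r => r%:C%C
  end.

Lemma modulus_of_real (r : R) : 0 <= r -> modulus (of_real r) = r.
Proof.
rewrite /modulus /of_real; case: k => /= r0; first exact: ger0_norm.
by rewrite expr0n/= addr0 sqrtr_sqr ger0_norm.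
Qed.

End Modulus.

(** * Quasi-norms, the topology they generate, and operator norms *)

Section QuasiNorm.
Context (R : realType) (k : scalar_kind) (X : quasiBanachType R k).
Local Notation K := (scalars R k).
Local Notation qn := (@quasi_norm R k X).
Implicit Types (f g h : X) (e : R).

Definition kappa : R := s2val (cid2 (@quasi_normD R k X)).

Lemma kappa_ge1 : 1 <= kappa.
Proof. by rewrite /kappa; case: cid2. Qed.

Lemma kappa_ge0 : 0 <= kappa.
Proof. exact: le_trans ler01 kappa_ge1. Qed.

Lemma qnormD f g : qn (f + g) <= kappa * (qn f + qn g).
Proof. by rewrite /kappa; case: cid2. Qed.

Lemma qnorm0 : qn 0 = 0.
Proof. by rewrite -(scale0r (0 : X)) quasi_normZ modulus0 mul0r. Qed.

Lemma qnormN f : qn (- f) = qn f.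
Proof. by rewrite -scaleN1r quasi_normZ modulusN modulus1 mul1r. Qed.

Lemma qnormB f g : qn (f - g) <= kappa * (qn f + qn g).
Proof. by rewrite -(qnormN g) qnormD. Qed.

Lemma qnorm_distC f g : qn (f - g) = qn (g - f).
Proof. by rewrite -qnormN opprB. Qed.

Lemma qnorm_gt0 f : f != 0 -> 0 < qn f.
Proof.
move=> f0; rewrite lt_neqAle quasi_norm_ge0 andbT eq_sym.
by apply: contra_neq f0; exact: quasi_norm_eq0.
Qed.

(** Since the quasi-norm may be discontinuous, equalities obtained by density or limits are proved
    by bounding the quasi-norm of the difference by a fixed multiple of every [e > 0]. *)
Lemma le_small_eq0 (r M : R) : 0 <= r -> (forall e, 0 < e -> r <= M * e) ->
  r = 0.
Proof.
move=> r0 rM; apply/eqP; rewrite eq_le r0 andbT; apply/ler_addgt0Pr => e e0.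
rewrite add0r; have M1 : 0 < `|M| + 1 by rewrite ltr_wpDl.
apply: le_trans (rM (e / (`|M| + 1)) _) _; first exact: divr_gt0.
rewrite mulrA ler_pdivrMr// mulrC ler_pM2l//.
by rewrite (le_trans (ler_norm _))// lerDl.
Qed.

Lemma nbhs_qnormP f (A : set X) :
  nbhs f A <-> exists2 e, 0 < e & forall g, qn (f - g) < e -> A g.
Proof.
rewrite -nbhs_entourageE entourage_quasi_normE; split.
  move=> [E [e e0 eE] EA]; exists e => // g fg; apply: EA.
  by apply/xsectionP; exact: eE.
move=> [e e0 eA]; exists [set fg | qn (fg.1 - fg.2) < e].
  by exists e.
by move=> g /xsectionP /=; exact: eA.
Qed.

Lemma cvg_qnormP (u : nat -> X) f :
  u @ \oo --> f <->
  forall e, 0 < e -> exists N, forall n, (N <= n)%N -> qn (f - u n) < e.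
Proof.
split=> [uf e e0|uf A /nbhs_qnormP[e e0 eA]].
  have /uf[N _ NA] : nbhs f [set g | qn (f - g) < e].
    by apply/nbhs_qnormP; exists e.
  by exists N => n Nn; exact: NA.
have [N NA] := uf e e0.
by exists N => // n Nn; apply: eA; exact: NA.
Qed.

Lemma qnorm_complete (u : nat -> X) :
  (forall e, 0 < e -> exists N, forall m n, (N <= m)%N -> (N <= n)%N ->
    qn (u m - u n) < e) ->
  exists f, u @ \oo --> f.
Proof.
move=> uC; apply: cauchy_converges => A.
rewrite /= entourage_quasi_normE => -[e e0 eA].
have [N uN] := uC e e0.
exists (u @` [set n | (N <= n)%N], u @` [set n | (N <= n)%N]) => /=.
  by split; exists N => // n /= Nn; exists n.
by move=> [_ _] /= [[m Nm <-] [n Nn <-]]; apply: eA => /=; exact: uN.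
Qed.

Lemma lipschitz_continuous_qnorm (T : {linear X -> X}) M :
  (forall f, qn (T f) <= M * qn f) -> continuous T.
Proof.
move=> TM f A /nbhs_qnormP[e e0 eA].
apply/nbhs_qnormP; exists (e / (`|M| + 1)).
  by rewrite divr_gt0// ltr_wpDl.
move=> g fg; apply: eA; rewrite -linearB.
move: fg; rewrite ltr_pdivlMr ?ltr_wpDl// => /(le_lt_trans _); apply.
rewrite (le_trans (TM _))// mulrC ler_wpM2l ?quasi_norm_ge0//.
by rewrite (le_trans (ler_norm _))// lerDl.
Qed.

Lemma le_operator_norm (T : {linear X -> X}) (M : R) :
  (operator_norm T <= M%:E)%E -> forall f, qn (T f) <= M * qn f.
Proof.
move=> TM f; have [->|f0] := eqVneq f 0; first by rewrite linear0 qnorm0 mulr0.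
have qf := qnorm_gt0 f0.
pose a := of_real k (qn f)^-1.
have ma : modulus a = (qn f)^-1 by rewrite modulus_of_real// invr_ge0 ltW.
have : ((qn (T (a *: f)))%:E <= M%:E)%E.
  apply: le_trans TM; apply: ereal_sup_ubound; exists (a *: f) => //=.
  by rewrite quasi_normZ ma mulVf// gt_eqF.
by rewrite lee_fin linearZ/= quasi_normZ ma mulrC ler_pdivrMr.
Qed.

Lemma operator_norm_le (T : X -> X) (M : R) :
  0 <= M -> (forall f, qn (T f) <= M * qn f) -> (operator_norm T <= M%:E)%E.
Proof.
move=> M0 TM; apply: ge_ereal_sup => _ [f /= f1 <-].
by rewrite lee_fin (le_trans (TM f))// ler_piMr.
Qed.

End QuasiNorm.

(** * Finite coordinate projections and greedy constants *)

Section Basis.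
Context (R : realType) (k : scalar_kind) (X : quasiBanachType R k).
Local Notation K := (scalars R k).
Local Notation qn := (@quasi_norm R k X).
Context (x : nat -> X) (xs : nat -> {scalar X}).
Context (x_basis : basis_with x xs) (x_semi : semi_normalized x).
Context (x_Mbdd : M_bounded x xs).
Implicit Types (f g h z : X) (s : seq nat).

Lemma coefE n j : xs n (x j) = (j == n)%:R.
Proof. by case: x_basis. Qed.

Lemma span_dense f e : 0 < e ->
  exists N (a : nat -> K), qn (f - \sum_(n < N) a n *: x n) < e.
Proof.
move=> e0; have [clX _ _] := x_basis.
have : closure (linear_span x) f by rewrite clX.
move=> /(_ [set g | qn (f - g) < e])[].
  by apply/nbhs_qnormP; exists e.
by move=> _ [[N [a ->]] fg]; exists N, a.
Qed.

Lemma basis_neq0 n : x n != 0.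
Proof.
apply/eqP => xn0; have := coefE n n.
by rewrite xn0 linear0 eqxx => /eqP; rewrite eq_sym oner_eq0.
Qed.

Lemma term_bound :
  exists2 M : R, 0 <= M & forall n f, qn (xs n f *: x n) <= M * qn f.
Proof.
have fn0 n : (0 <= functional_norm (xs n))%E.
  apply: ereal_sup_ubound; exists 0; first by rewrite /= qnorm0 ler01.
  by rewrite linear0 modulus0.
have := x_Mbdd; rewrite /M_bounded; set S := ereal_sup _ => Soo.
have leS n : ((qn (x n))%:E * functional_norm (xs n) <= S)%E.
  by apply: ereal_sup_ubound; exists n.
have S0 : (0 <= S)%E.
  by apply: le_trans (leS 0); rewrite mule_ge0// lee_fin quasi_norm_ge0.
have Sfin : S \is a fin_num by rewrite ge0_fin_numE.
exists (fine S) => [|n f]; first exact: fine_ge0.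
have [->|f0] := eqVneq f 0; first by rewrite linear0 scale0r !qnorm0 mulr0.
have qf := qnorm_gt0 f0.
pose a := of_real k (qn f)^-1.
have ma : modulus a = (qn f)^-1 by rewrite modulus_of_real// invr_ge0 ltW.
have : ((qn (xs n (a *: f) *: x n))%:E <= (fine S)%:E)%E.
  rewrite fineK//; apply: le_trans (leS n).
  rewrite quasi_normZ mulrC EFinM.
  rewrite lee_pmul2l//; last exact: qnorm_gt0 (basis_neq0 n).
  apply: ereal_sup_ubound; exists (a *: f) => //=.
  by rewrite quasi_normZ ma mulVf// gt_eqF.
by rewrite lee_fin linearZ/= -scalerA quasi_normZ ma mulrC ler_pdivrMr.
Qed.

(** The term bound is divided by the infimum of [qn (x n)], positive by semi-normalization. *)
Lemma coef_bound :
  exists2 M : R, 0 <= M & forall n f, modulus (xs n f) <= M * qn f.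
Proof.
have [M M0 Mx] := term_bound.
have [inf0 _] := x_semi; set I := ereal_inf _ in inf0.
have leI n : (I <= (qn (x n))%:E)%E by apply: ereal_inf_lbound; exists n.
have Ifin : I \is a fin_num.
  by rewrite ge0_fin_numE ?(ltW inf0)// (le_lt_trans (leI 0))// ltry.
have c0 : 0 < fine I by rewrite fine_gt0// inf0 ltey_eq Ifin.
exists (M / fine I) => [|n f]; first by rewrite divr_ge0// ltW.
rewrite mulrAC ler_pdivlMr//; apply: le_trans (Mx n f).
rewrite quasi_normZ ler_wpM2l ?modulus_ge0//.
by rewrite -lee_fin fineK.
Qed.

Definition proj s f : X := \sum_(n <- s) xs n f *: x n.

Lemma proj_is_linear s : linear (proj s).
Proof.
move=> a f g; rewrite /proj scaler_sumr -big_split/=; apply: eq_bigr => n _.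
by rewrite linearP scalerDl scalerA.
Qed.

HB.instance Definition _ s :=
  GRing.isLinear.Build K X X *:%R (proj s) (proj_is_linear s).

Lemma proj_basis s m : uniq s -> proj s (x m) = if m \in s then x m else 0.
Proof.
rewrite /proj; elim: s => [_|n s IH /= /andP[ns us]]; first by rewrite big_nil.
rewrite big_cons IH// coefE inE; case: eqP => [->|_] /=.
  by rewrite (negbTE ns) addr0 scale1r.
by rewrite scale0r add0r.
Qed.

Lemma coef_proj s m f : uniq s ->
  xs m (proj s f) = if m \in s then xs m f else 0.
Proof.
rewrite /proj; elim: s => [_|n s IH /= /andP[ns us]].
  by rewrite big_nil linear0.
rewrite big_cons linearD linearZ/= IH// coefE inE eq_sym.
case: eqP => [->|_] /=; first by rewrite (negbTE ns) addr0 mulr1.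
by rewrite mulr0 add0r.
Qed.

Lemma proj_span s N (a : nat -> K) : uniq s -> {subset iota 0 N <= s} ->
  proj s (\sum_(n < N) a n *: x n) = \sum_(n < N) a n *: x n.
Proof.
move=> us sN; rewrite linear_sum; apply: eq_bigr => n _.
by rewrite linearZ/= proj_basis// sN// mem_iota/=.
Qed.

Lemma coord_proj_seq s f : uniq s -> coord_proj x xs [set` s] f = proj s f.
Proof. by move=> us; rewrite /coord_proj -fsbig_seq. Qed.

Lemma finite_set_uniq (A : set nat) : finite_set A ->
  exists2 s, uniq s & A = [set` s].
Proof.
move=> fA; exists (finmap.enum_fset (fset_set A)).
  exact: finmap.fset_uniq.
by rewrite -[LHS](fset_setK fA).
Qed.

(** Each new term costs one factor [kappa], so the constant depends on the length only, not on the
    indices. *)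
Lemma proj_size_bound m : exists2 M : R, 0 <= M &
  forall s f, (size s <= m)%N -> qn (proj s f) <= M * qn f.
Proof.
have [M M0 Mx] := term_bound.
elim: m => [|m [L L0 IH]].
  exists 0 => // s f; rewrite leqn0 size_eq0 => /eqP ->.
  by rewrite /proj big_nil qnorm0 mul0r.
exists (kappa X * (M + L)) => [|[|n s] f /= sm].
- by rewrite mulr_ge0 ?kappa_ge0// addr_ge0.
- rewrite /proj big_nil qnorm0 !mulr_ge0 ?quasi_norm_ge0 ?kappa_ge0//.
  by rewrite addr_ge0.
- rewrite /proj big_cons (le_trans (qnormD _ _))// -mulrA mulrDl.
  by rewrite ler_wpM2l ?kappa_ge0// lerD ?Mx// IH.
Qed.

(* The greedy condition controls the complements f - P_s f without a factor
   kappa, unlike the projections P_s f themselves. *)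
Definition complement_bound (C : R) : Prop :=
  forall s f, uniq s -> qn (f - proj s f) <= C * qn f.

Lemma proj_approx C f e : complement_bound C -> 0 < e ->
  exists N, forall s, uniq s -> {subset iota 0 N <= s} ->
    qn (f - proj s f) < e.
Proof.
move=> HC e0; have C1 : 0 < `|C| + 1 by rewrite ltr_wpDl.
have [N [a fg]] := span_dense f (divr_gt0 e0 C1).
exists N => s us sN; set g := \sum_(n < N) _ in fg.
(* [proj s] fixes the span element [g], so the complement bound applies to the small vector [f - g]
   and no factor [kappa] appears. *)
have -> : f - proj s f = (f - g) - proj s (f - g).
  by rewrite linearB /= [X in _ - (_ - X)]proj_span// opprB addrA subrK.
rewrite (le_lt_trans (HC _ _ us))//.
move: fg; rewrite ltr_pdivlMr// => /(le_lt_trans _); apply.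
rewrite mulrC ler_wpM2l ?quasi_norm_ge0//.
by rewrite (le_trans (ler_norm _))// lerDl.
Qed.

(** Enlarging [s] does not change the projection of [z], whose other coordinates vanish, while
    projections along large sets approximate [z]. *)
Lemma finite_supp_proj C s z : complement_bound C -> uniq s ->
  supp xs z `<=` [set` s] -> proj s z = z.
Proof.
move=> HC us zs; apply/esym/eqP; rewrite -subr_eq0; apply/eqP/quasi_norm_eq0.
apply: (@le_small_eq0 _ _ 1) => [|e e0]; first exact: quasi_norm_ge0.
have [N zN] := proj_approx z HC e0; rewrite mul1r ltW//.
pose t := undup (s ++ iota 0 N).
have -> : proj s z = proj t z; last first.
  by apply: zN; [exact: undup_uniq|move=> n nN; rewrite mem_undup mem_cat nN orbT].
rewrite -!coord_proj_seq ?undup_uniq// /coord_proj; apply: fsbig_widen.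
  by move=> n /= ns; rewrite mem_undup mem_cat ns.
move=> n [/= _ ns]; have [->|zn] := eqVneq (xs n z) 0; first exact: scale0r.
by have := zs n zn.
Qed.

Lemma greedy_complement_bound C : greedy_with x xs C -> complement_bound C.
Proof.
move=> [_ gC] s f us; have [M M0 Mf] := coef_bound.
(* The coefficients of [f] are at most [M * qn f]; after adding [t], those on [s] are at least this
   large, so [s] is a greedy set of [f + z]. *)
pose t := of_real k (2 * (M * qn f)).
have mt : modulus t = 2 * (M * qn f).
  by rewrite modulus_of_real// !mulr_ge0 ?quasi_norm_ge0.
pose z := \sum_(n <- s) t *: x n.
have zx n : xs n z = if n \in s then t else 0.
  rewrite /z; elim: (s) us => [_|m r IH /= /andP[mr ur]].
    by rewrite big_nil linear0.
  rewrite big_cons linearD linearZ/= IH// coefE inE eq_sym.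
  case: eqP => [->|_] /=; first by rewrite (negbTE mr) addr0 mulr1.
  by rewrite mulr0 add0r.
have pz : proj s z = z by apply: eq_big_seq => n ns; rewrite zx ns.
(* As [proj s] fixes [z], the greedy remainder of [f + z] is [f - proj s f]. *)
have := gC (f + z) z [set` s] (finite_seq s).
rewrite coord_proj_seq// addrK linearD/= pz opprD addrACA subrr addr0; apply.
- move=> n j /= ns js; rewrite !linearD/= !zx ns; case: ifPn => // _.
  rewrite addr0 (le_trans (Mf j f))//.
  have := modulusD (xs n f + t) (- xs n f).
  rewrite addrAC subrr add0r modulusN mt.
  by have := Mf n f; lra.
- apply: subset_card_le => n; rewrite /supp /= zx.
  by case: ifPn => //; rewrite eqxx.
Qed.

(** The projection on [B] is an admissible [z]: its support lies in [B]. *)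
Lemma greedy_almost_greedy C : greedy_with x xs C -> almost_greedy_with x xs C.
Proof.
move=> [C1 gC]; split=> // f A B fA gA BA; apply: gC => //.
apply: (card_le_trans _ BA); apply: subset_card_le => n; rewrite /supp /=.
have fB := card_le_finite BA fA.
have [s us ->] := finite_set_uniq fB.
by rewrite coord_proj_seq// coef_proj//; case: ifP => //; rewrite eqxx.
Qed.

Lemma almost_greedy_greedy C L : almost_greedy_with x xs C ->
  1 <= L -> complement_bound L -> greedy_with x xs (C * L).
Proof.
move=> [C1 agC] L1 HL; split; first by rewrite mulr_ege1.
move=> f z A fA gA zA; have fz := card_le_finite zA fA.
apply: le_trans (agC f A _ fA gA zA) _.
rewrite -mulrA ler_wpM2l ?(le_trans ler01)//.
have [s us zs] := finite_set_uniq fz.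
rewrite zs coord_proj_seq//.
have pz : proj s z = z by apply: finite_supp_proj HL us _; rewrite zs.
suff -> : f - proj s f = (f - z) - proj s (f - z) by exact: HL.
by rewrite linearB/= pz opprB addrA subrK.
Qed.

End Basis.

(** * Uniqueness and linearity of limits *)

Section QuasiNormLimits.
Context (R : realType) (k : scalar_kind) (X : quasiBanachType R k).
Local Notation K := (scalars R k).
Local Notation qn := (@quasi_norm R k X).
Implicit Types f g : X.

Lemma cvg_qnorm_unique (u : nat -> X) f g :
  u @ \oo --> f -> u @ \oo --> g -> f = g.
Proof.
move=> /cvg_qnormP uf /cvg_qnormP ug.
apply/eqP; rewrite -subr_eq0; apply/eqP/quasi_norm_eq0.
apply: (@le_small_eq0 _ _ (kappa X * 2)) => [|e e0]; first exact: quasi_norm_ge0.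
have [[N fN] [M gM]] := (uf e e0, ug e e0); pose n := maxn N M.
have -> : f - g = (f - u n) - (g - u n) by rewrite opprB addrA subrK.
rewrite (le_trans (qnormB _ _))// -mulrA ler_wpM2l ?kappa_ge0//.
have := fN n (leq_maxl _ _); have := gM n (leq_maxr _ _); lra.
Qed.

Lemma cvg_qnorm_linear (u v : nat -> X) (a : K) f g :
  u @ \oo --> f -> v @ \oo --> g ->
  (fun n => a *: u n + v n : X) @ \oo --> (a *: f + g : X).
Proof.
move=> /cvg_qnormP uf /cvg_qnormP vg; apply/cvg_qnormP => e e0.
have c0 : 0 < kappa X * (modulus a + 1).
  by rewrite mulr_gt0 ?(lt_le_trans ltr01) ?kappa_ge1 ?lerDr ?modulus_ge0.
have d0 := divr_gt0 e0 c0; set d := e / _ in d0.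
have [[N fN] [M gM]] := (uf d d0, vg d d0).
exists (maxn N M) => n; rewrite geq_max => /andP[/fN fn /gM gn].
rewrite opprD addrACA -scalerBr (le_lt_trans (qnormD _ _))// quasi_normZ.
rewrite (_ : e = kappa X * ((modulus a + 1) * d)); last first.
  by rewrite mulrA [RHS]mulrC divfK// gt_eqF.
rewrite ltr_pM2l ?(lt_le_trans ltr01) ?kappa_ge1// mulrDl mul1r ler_ltD//.
by rewrite ler_wpM2l ?modulus_ge0// ltW.
Qed.

End QuasiNormLimits.

(** * Suppression operators, [K_su] and unconditional expansions *)

Section SuppressionOperators.
Context (R : realType) (k : scalar_kind) (X : quasiBanachType R k).
Local Notation K := (scalars R k).
Local Notation qn := (@quasi_norm R k X).
Context (x : nat -> X) (xs : nat -> {scalar X}).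
Context (x_basis : basis_with x xs) (x_semi : semi_normalized x).
Context (x_Mbdd : M_bounded x xs).
Implicit Types (f g h z : X) (s : seq nat).

(** An extension [T] of the suppression operator for the complement of [s] agrees with
    [f - proj x xs s f] on the span, hence everywhere by boundedness and density. The strict
    inequality lets the infimum [coord_proj_norm] supply an actual [T] of norm below [L]. *)
Lemma K_su_complement_bound L : (K_su x < L%:E)%E -> complement_bound x xs L.
Proof.
move=> KL s f us.
have : (coord_proj_norm x (~` [set` s]) < L%:E)%E.
  by apply: le_lt_trans KL; apply: ereal_sup_ubound; exists (~` [set` s]).
move=> /ereal_inf_lt[_ [T [_ Tx] <-]] /ltW/le_operator_norm TL.
suff -> : f - proj x xs s f = T f by exact: TL.
have [M M0 sM] := proj_size_bound x_basis x_Mbdd (size s).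
pose D h := h - proj x xs s h - T h.
have DB g h : D (g - h) = D g - D h.
  by rewrite /D !linearB/= !opprK [RHS]addrACA [X in _ = X + _]addrACA.
have Dx N (a : nat -> K) : D (\sum_(n < N) a n *: x n) = 0.
  rewrite /D (linear_sum T) (linear_sum (proj x xs s)) -!sumrB big1// => n _ /=.
  rewrite [proj _ _ _ _]linearZ [T _]linearZ/= -!scalerBr.
  rewrite (proj_basis x_basis)//; have [T1 T0] := Tx n.
  case: ifPn => ns; first by rewrite T0 ?subrr ?subr0 ?scaler0//; apply; exact: ns.
  by rewrite T1 ?subr0 ?subrr ?scaler0//; exact/negP.
suff : D f = 0 by move/eqP; rewrite /D subr_eq0 => /eqP.
apply: quasi_norm_eq0.
apply: (@le_small_eq0 _ _ (kappa X * (kappa X * (1 + M) + `|L|))).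
  exact: quasi_norm_ge0.
move=> e e0; have [N [a fg]] := span_dense x_basis f e0.
set g := \sum_(n < N) _ in fg.
have -> : D f = D (f - g) by rewrite DB Dx subr0.
set h := f - g in fg *.
rewrite /D (le_trans (qnormB _ _))// -mulrA ler_wpM2l ?kappa_ge0// mulrDl.
apply: lerD; last first.
  rewrite (le_trans (TL h))// (le_trans (ler_wpM2r _ (ler_norm L)))//.
    exact: quasi_norm_ge0.
  by rewrite ler_wpM2l// ltW.
rewrite (le_trans (qnormB _ _))// -mulrA ler_wpM2l ?kappa_ge0// mulrDl mul1r.
by rewrite lerD ?(ltW fg)// (le_trans (sM _ _ _))// ler_wpM2l// ltW.
Qed.

(** For the full index set every extension fixes the normalized [x 0]. *)
Lemma K_su_ge1 : (1 <= K_su x)%E.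
Proof.
apply: le_trans (ereal_sup_ubound _); last by exists setT.
apply: le_ereal_inf_tmp => _ [T [_ Tx] <-].
have qx := qnorm_gt0 (basis_neq0 x_basis 0%N).
pose a := of_real k (qn (x 0%N))^-1.
have qa : qn (a *: x 0%N) = 1.
  by rewrite quasi_normZ modulus_of_real ?invr_ge0 ?ltW// mulVf// gt_eqF.
apply: ereal_sup_ubound; exists (a *: x 0%N); first by rewrite /= qa.
by rewrite linearZ/= (Tx 0%N).1// qa.
Qed.

(** [coef_bound] carries coordinates to the limit; the form with an eventual constant suits partial
    sums whose later terms leave coordinate [n] unchanged. *)
Lemma cvg_coef (u : nat -> X) f n N (c : K) : u @ \oo --> f ->
  (forall m, (N <= m)%N -> xs n (u m) = c) -> xs n f = c.
Proof.
move=> /cvg_qnormP uf uc; have [M M0 Mf] := coef_bound x_basis x_semi x_Mbdd.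
apply/eqP; rewrite -subr_eq0; apply/eqP/modulus_eq0.
apply: (@le_small_eq0 _ _ M) => [|e e0]; first exact: modulus_ge0.
have [N' fN'] := uf e e0; rewrite -(uc (maxn N N')) ?leq_maxl// -linearB.
by rewrite (le_trans (Mf _ _))// ler_wpM2l// ltW// fN'// leq_maxr.
Qed.

Lemma cvg_series_coef (a : nat -> K) f n :
  series (fun n => a n *: x n) @ \oo --> f -> a n = xs n f.
Proof.
move=> af; apply/esym; apply: (cvg_coef af (N := n.+1)) => m nm.
rewrite /series/= big_mkord linear_sum (bigD1 (Ordinal nm))//= linearZ/=.
rewrite (coefE x_basis) eqxx mulr1 big1 ?addr0// => i /negbTE ni.
rewrite linearZ/= (coefE x_basis).
by rewrite -(inj_eq val_inj)/= in ni; rewrite ni mulr0.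
Qed.

(** Rearranged partial sums are eventually projections on sets containing a given initial segment.
    For uniqueness, the identity rearrangement already determines the coefficients. *)
Lemma complement_bound_unconditional C :
  complement_bound x xs C -> unconditional x.
Proof.
move=> HC f; exists (xs^~ f); split => [s [g sg gs]|a fa]; last first.
  by apply/esym/funext => n; apply: cvg_series_coef; apply: (fa id); exists id.
apply/cvg_qnormP => e e0; have [N fN] := proj_approx x_basis f HC e0.
(* [g] inverts [s], so after this many terms all indices below [N] have occurred. *)
exists (\max_(m < N) (g m).+1) => n Nn.
have -> : series ((fun n => xs n f *: x n) \o s) n =
    proj x xs (map s (iota 0 n)) f.
  by rewrite /proj big_map /series/= /index_iota subn0.
apply: fN; first by rewrite map_inj_uniq ?iota_uniq//; exact: can_inj sg.
move=> m; rewrite mem_iota/= => mN; apply/mapP; exists (g m); last by rewrite gs.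
rewrite mem_iota/=; apply: leq_trans Nn.
exact: (leq_bigmax (Ordinal mN)).
Qed.

Lemma complement_bound_extends C (A : set nat) :
  complement_bound x xs C -> continuous (qn : X -> R) ->
  exists2 T : {linear X -> X}, extends_coord_proj x A T &
    forall f, qn (T f) <= C * qn f.
Proof.
(* Removing the indices below [N] outside [A], rather than projecting on those in [A], keeps the
   constant [C]. *)
move=> HC cqn; pose r N := [seq n <- iota 0 N | n \notin A].
have ur N : uniq (r N) by rewrite filter_uniq ?iota_uniq.
pose Q N f := f - proj x xs (r N) f.
have Qlin N a f g : Q N (a *: f + g) = a *: Q N f + Q N g.
  by rewrite /Q linearP/= opprD addrACA -scalerBr.
have Qx N n : (n < N)%N -> Q N (x n) = if n \in A then x n else 0.
  move=> nN; rewrite /Q (proj_basis x_basis)// mem_filter mem_iota nN andbT.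
  by case: (n \in A) => /=; rewrite ?subr0 ?subrr.
have Qcvg f : exists g : X, (Q^~ f : nat -> X) @ \oo --> g.
  apply: qnorm_complete => e e0.
  have c0 : 0 < kappa X * ((`|C| + 1) * 2).
    by rewrite !mulr_gt0 ?ltr_wpDl// (lt_le_trans ltr01)// kappa_ge1.
  have [N [a fg]] := span_dense x_basis f (divr_gt0 e0 c0).
  set g := \sum_(n < N) _ in fg.
  (* On a fixed span element [Q m] is eventually constant, so the Cauchy estimate reduces to the
     small vector [f - g]. *)
  have Qg m : (N <= m)%N -> Q m g = \sum_(n < N | val n \in A) a n *: x n.
    move=> Nm; rewrite big_mkcond /Q (linear_sum (proj x xs (r m))) -sumrB.
    apply: eq_bigr => i _ /=; rewrite [proj _ _ _ _]linearZ -scalerBr.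
    rewrite [x i - _]Qx ?(leq_trans (ltn_ord i))//.
    by case: ifP; rewrite ?scaler0.
  exists N => m n Nm Nn.
  have QB j : Q j f = Q j (f - g) + Q j g.
    by have := Qlin j 1 (f - g) g; rewrite !scale1r subrK.
  rewrite !QB !Qg// opprD addrACA subrr addr0 (le_lt_trans (qnormB _ _))//.
  move: fg; rewrite ltr_pdivlMr// => /(le_lt_trans _); apply.
  rewrite mulrCA ler_wpM2l ?kappa_ge0//.
  have CC j : qn (Q j (f - g)) <= (`|C| + 1) * qn (f - g).
    rewrite (le_trans (HC _ _ (ur j)))// ler_wpM2r ?quasi_norm_ge0//.
    by rewrite (le_trans (ler_norm _))// lerDl.
  by have := CC m; have := CC n; lra.
pose T f := sval (cid (Qcvg f)).
have QT f : (Q^~ f : nat -> X) @ \oo --> (T f : X) by rewrite /T; case: cid.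
have Tlin : linear T.
  move=> a f g; apply: cvg_qnorm_unique (QT _) _.
  rewrite (_ : Q^~ _ = fun N => a *: Q N f + Q N g).
    exact: cvg_qnorm_linear.
  by apply/funext => N; exact: Qlin.
pose lT : {linear X -> X} := HB.pack T (GRing.isLinear.Build K X X *:%R T Tlin).
have TC f : qn (lT f) <= C * qn f.
  (* Continuity of the quasi-norm passes the bound [C] to the limit unchanged. *)
  have qQ : (qn \o Q^~ f : nat -> R) @ \oo --> (qn (T f) : R).
    by apply: cvg_comp (QT f) _; exact: cqn.
  apply: (cvgr_to_le qQ); apply: nearW => n /=; exact: HC.
exists lT => //; split; first exact: lipschitz_continuous_qnorm TC.
have Tx n : T (x n) = if n \in A then x n else 0.
  apply: cvg_qnorm_unique (QT _) _; apply/cvg_qnormP => e e0.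
  by exists n.+1 => m nm; rewrite Qx// subrr qnorm0.
move=> n; rewrite /= Tx; split=> nA; first by rewrite mem_set.
by rewrite memNset.
Qed.

Lemma complement_bound_K_su C : 0 <= C -> complement_bound x xs C ->
  continuous (qn : X -> R) -> (K_su x <= C%:E)%E.
Proof.
move=> C0 HC cqn; apply: ge_ereal_sup => _ [A _ <-].
have [T TA TC] := complement_bound_extends A HC cqn.
apply: le_trans (operator_norm_le C0 TC).
by apply: ereal_inf_lbound; exists T.
Qed.

End SuppressionOperators.

(** * Rearranging finite blocks into consecutive positions *)

(** This turns finite sets arbitrarily far out into runs of consecutive terms of a single rearranged
    series. Only the [E M] at block starts [M] are used, and these starts are unbounded. *)
Lemma block_rearrangement (E : nat -> seq nat) :
  (forall N, uniq (E N)) -> (forall N n, n \in E N -> (N <= n)%N) ->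
  exists2 p : nat -> nat, bijective p &
    forall N, exists2 M, (N <= M)%N & map p (iota M (size (E M))) = E M.
Proof.
move=> uE EN.
(* p lists each successive block [M, M + w M) with the elements of E M first. *)
pose w M := (\max_(n <- E M) n).+1.
pose B M := E M ++ [seq n <- iota M (w M) | n \notin E M].
have EB M : perm_eq (B M) (iota M (w M)).
  apply: uniq_perm; rewrite ?iota_uniq//.
    rewrite cat_uniq uE filter_uniq ?iota_uniq// andbT; apply/hasPn => n.
    by rewrite mem_filter => /andP[].
  move=> n; rewrite mem_cat mem_filter mem_iota.
  case: (boolP (n \in E M)) => //= nE; rewrite EN//= addnS ltnS; apply/esym.
  by rewrite (leq_trans _ (leq_addl _ _))//; exact: leq_bigmax_seq.
(* [L j] joins the first [j] blocks; its length is where the next block starts. *)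
pose L := fix L j := if j is i.+1 then L i ++ B (size (L i)) else [::].
have Lperm j : perm_eq (L j) (iota 0 (size (L j))).
  elim: j => //= j IH; rewrite size_cat iotaD add0n perm_cat//.
  by rewrite (perm_size (EB _)) size_iota.
have sizeL j : (j <= size (L j))%N.
  elim: j => //= j IH; rewrite size_cat (perm_size (EB _)) size_iota.
  by rewrite addnS ltnS (leq_trans IH)// leq_addr.
have LD i j n : (n < size (L i))%N -> nth 0%N (L (j + i)) n = nth 0%N (L i) n.
  move=> ni; have si m : (size (L i) <= size (L (m + i)))%N.
    by elim: m => //= m /leq_trans; apply; rewrite size_cat leq_addr.
  by elim: j => //= j <-; rewrite nth_cat ifT// (leq_trans ni).
(* [L n.+1] has at least [n.+1] entries and later lists extend it, so position [n] is settled there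
   and the default 0 is not reached. *)
pose p n := nth 0%N (L n.+1) n.
have pE j n : (n < size (L j))%N -> p n = nth 0%N (L j) n.
  move=> nj; rewrite /p; have [le|/ltnW le] := leqP j n.+1.
    by rewrite -(subnK le) LD.
  by rewrite -[in RHS](subnK le) LD.
have pinj : injective p.
  move=> m n; pose j := (maxn m n).+1.
  have mj : (m < size (L j))%N by rewrite (leq_trans _ (sizeL _))// ltnS leq_maxl.
  have nj : (n < size (L j))%N by rewrite (leq_trans _ (sizeL _))// ltnS leq_maxr.
  rewrite (pE j)// (pE j)// => /eqP; rewrite nth_uniq//; first by move/eqP.
  by rewrite (perm_uniq (Lperm j)) iota_uniq.
pose g n := index n (L n.+1).
have pg : cancel g p.
  move=> n; have nL : n \in L n.+1 by rewrite (perm_mem (Lperm _)) mem_iota sizeL.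
  by rewrite /g (pE n.+1) ?nth_index// index_mem.
exists p; first by exists g => // n; apply: pinj; exact: pg.
move=> N; exists (size (L N)); first exact: sizeL.
set M := size (L N).
have EBM : (size (E M) <= size (B M))%N by rewrite size_cat leq_addr.
apply: (@eq_from_nth _ 0%N); first by rewrite size_map size_iota.
move=> i; rewrite size_map size_iota => iE.
rewrite (nth_map 0%N) ?size_iota// nth_iota// (pE N.+1).
  by rewrite /= nth_cat -/M ltnNge leq_addr/= addKn nth_cat iE.
by rewrite /= size_cat ltn_add2l (leq_trans iE).
Qed.

(** * From unconditionality to a complement bound *)

Section UnconditionalBound.
Context (R : realType) (k : scalar_kind) (X : quasiBanachType R k).
Local Notation K := (scalars R k).
Local Notation qn := (@quasi_norm R k X).
Context (x : nat -> X) (xs : nat -> {scalar X}).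
Context (x_basis : basis_with x xs) (x_semi : semi_normalized x).
Context (x_Mbdd : M_bounded x xs).
Implicit Types (f g h z : X) (s : seq nat).

(** Otherwise blocks with sum of quasi-norm at least [e] exist beyond every [N], and one
    rearrangement makes infinitely many of them differences of its partial sums, so it diverges. *)
Lemma unconditionally_sums_cauchy (u : nat -> X) f e :
  unconditionally_sums u f -> 0 < e ->
  exists N, forall s, uniq s -> (forall n, n \in s -> (N <= n)%N) ->
    qn (\sum_(n <- s) u n) < e.
Proof.
move=> uf e0; apply: contrapT => /forallNP noN.
have /choice[E HE] : forall N, exists s, [/\ uniq s,
    forall n, n \in s -> (N <= n)%N & e <= qn (\sum_(n <- s) u n)].
  move=> N; apply: contrapT => /forallNP nos; apply: (noN N) => s us sN.
  by rewrite ltNge; apply/negP => es; exact: (nos s).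
have [||p pbij pE] := @block_rearrangement E; [by move=> N; case: (HE N)..|].
have c0 : 0 < kappa X * 2 by rewrite mulr_gt0// (lt_le_trans ltr01)// kappa_ge1.
have /cvg_qnormP/(_ _ (divr_gt0 e0 c0))[N fN] := uf p pbij.
have [M NM pM] := pE N; have [_ _] := HE M; apply/negP; rewrite -ltNge.
have -> : \sum_(n <- E M) u n =
    (f - series (u \o p) M) - (f - series (u \o p) (M + size (E M))).
  rewrite opprB [f - _]addrC addrACA subrr addr0 addrC -[in LHS]pM big_map.
  rewrite /series/= (big_cat_nat (leq0n M) (leq_addr _ _))/= addrAC subrr add0r.
  by rewrite /index_iota addKn.
rewrite (le_lt_trans (qnormB _ _))//.
have := fN M NM; have := fN (M + size (E M))%N (leq_trans NM (leq_addr _ _)).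
set a := qn _; set b := qn _; rewrite !ltr_pdivlMr//; nra.
Qed.

Lemma unconditional_expansion f : unconditional x ->
  unconditionally_sums (fun n => xs n f *: x n) f.
Proof.
move=> /(_ f)[a [fa _]]; rewrite (_ : (fun n => _) = (fun n => a n *: x n))//.
apply/funext => n; congr (_ *: _); apply/esym.
apply: (cvg_series_coef x_basis x_semi x_Mbdd).
by apply: (fa id); exists id.
Qed.

(** A vector with a huge projection keeps one when its first [N] coordinates are dropped, at bounded
    cost, and its tail is cut where the expansion is close to it; rescaling gives the bump. One
    tuple packs the witnesses for a later choice. *)
Lemma unbounded_bump : unconditional x ->
  ~ (exists L : R, forall s f, uniq s -> qn (proj x xs s f) <= L * qn f) ->
  forall N (e : R), 0 < e -> exists t : X * seq nat * nat,
    let: (g, s, N') := t in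
    [/\ uniq s, (N < N')%N, forall n, n \in s -> (N <= n < N')%N,
        forall n, ~~ (N <= n < N')%N -> xs n g = 0 &
        qn g <= e /\ 1 <= qn (proj x xs s g)].
Proof.
move=> ux noL N e e0; have [M M0 NM] := proj_size_bound x_basis x_Mbdd N.
have k1 := kappa_ge1 X; have k0 : 0 < kappa X by rewrite (lt_le_trans ltr01).
(* [D * qn f] will bound the truncation [h], a difference of two remainders of [f]: at most
   [kappa * (1 + M) * qn f] at [N], and [qn f] at [N']. *)
pose D := kappa X * (1 + kappa X * (1 + M)).
(* The [M] part pays for the indices of [s] below [N]; what is left is [D / e * qn f < b], so [h]
   divided by [b] has quasi-norm at most [e]. *)
have [s [f [us]]] : exists s f, uniq s /\
    kappa X * (M + D / e) * qn f < qn (proj x xs s f).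
  apply: contrapT => nosf; apply: noL; exists (kappa X * (M + D / e)) => s f us.
  by rewrite leNgt; apply/negP => sf; apply: nosf; exists s, f.
have [->|f0] := eqVneq f 0; first by rewrite linear0 qnorm0 mulr0 ltxx.
have qf := qnorm_gt0 f0.
have uxf := unconditional_expansion (f := f) ux.
have /cvg_qnormP/(_ _ qf)[N1 fN1] := uxf id (inv_bij (fun=> erefl)).
pose s2 := [seq n <- s | (N <= n)%N]; pose s1 := [seq n <- s | ~~ (N <= n)%N].
have -> : proj x xs s f = proj x xs s1 f + proj x xs s2 f.
  by rewrite /proj !big_filter addrC [LHS](bigID (fun n => (N <= n)%N)).
have s1N : (size s1 <= N)%N.
  rewrite -[leqRHS](size_iota 0); apply: uniq_leq_size; first exact: filter_uniq.
  by move=> n; rewrite mem_filter mem_iota -ltnNge => /andP[].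
move=> /lt_le_trans/(_ (qnormD _ _)); rewrite -mulrA ltr_pM2l//.
move=> /lt_le_trans/(_ (lerD (NM _ _ s1N) (lexx _))).
rewrite mulrDl ltrD2l; set b := qn (proj x xs s2 f) => fb.
pose N' := maxn N1 (maxn N (\max_(n <- s) n)).+1.
have NN' : (N < N')%N by rewrite leq_max ltnS leq_maxl orbT.
have s2N' n : n \in s2 -> (N <= n < N')%N.
  rewrite mem_filter => /andP[-> ns] /=; rewrite leq_max ltnS leq_max.
  by rewrite leq_bigmax_seq ?orbT.
have uI m n : uniq (iota m n) := iota_uniq m n.
pose h := proj x xs (iota N (N' - N)) f.
have hE n : xs n h = if (N <= n < N')%N then xs n f else 0.
  by rewrite (coef_proj x_basis)// mem_iota subnKC// ltnW.
have qh : qn h <= D * qn f.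
  have -> : h = (f - proj x xs (iota 0 N) f) - (f - proj x xs (iota 0 N') f).
    rewrite opprB [f - _]addrC addrACA subrr addr0 addrC /proj.
    by rewrite -[in iota 0 N'](subnKC (ltnW NN')) iotaD big_cat/= addrAC subrr add0r.
  rewrite (le_trans (qnormB _ _))// /D -mulrA ler_pM2l// addrC mulrDl mul1r.
  apply: lerD.
    apply/ltW; rewrite -[X in f - X]/(\sum_(n <- iota 0 N') _).
    have := fN1 N' (leq_maxl _ _).
    by rewrite /series/= /index_iota subn0.
  rewrite (le_trans (qnormB _ _))// -mulrA ler_pM2l// mulrDl mul1r lerD2l.
  by apply: NM; rewrite size_iota.
have ph : proj x xs s2 h = proj x xs s2 f.
  by apply: eq_big_seq => n /s2N' nN; rewrite hE nN.
have b0 : 0 < b.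
  apply: (le_lt_trans _ fb); rewrite mulr_ge0 ?quasi_norm_ge0// divr_ge0 ?(ltW e0)//.
  by rewrite !(mulr_ge0, addr_ge0)// ltW.
pose a := of_real k b^-1.
have ma : modulus a = b^-1 by rewrite modulus_of_real// invr_ge0 ltW.
exists (a *: h, s2, N'); split => //; first exact: filter_uniq.
  by move=> n /negbTE nN; rewrite linearZ/= hE nN mulr0.
split.
  rewrite quasi_normZ ma mulrC ler_pdivrMr// (le_trans qh)//.
  by move: fb; rewrite mulrAC ltr_pdivrMr// [b * e]mulrC => /ltW.
by rewrite linearZ/= ph quasi_normZ ma mulVf// gt_eqF.
Qed.

(** The ratio absorbs the factor [kappa] paid at each term: with [c = kappa * 2] and [r = c^-1],
    splitting off the first term of a tail gives [kappa * (r ^ n + c * r ^ n.+1) = c * r ^ n]. *)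
Lemma geometric_series_cvg (g : nat -> X) :
  (forall j, qn (g j) <= (kappa X * 2)^-1 ^+ j) ->
  exists f, series g @ \oo --> f.
Proof.
move=> gr; pose c := kappa X * 2; pose r := c^-1.
have k1 := kappa_ge1 X.
have c0 : 0 < c by rewrite mulr_gt0// (lt_le_trans ltr01).
have r0 : 0 < r by rewrite invr_gt0.
have r1 : r < 1 by rewrite invf_lt1// /c; lra.
have tail m n : qn (\sum_(n <= j < n + m) g j) <= c * r ^+ n.
  elim: m n => [|m IH] n.
    by rewrite addn0 big_geq// qnorm0 mulr_ge0// ltW// exprn_gt0.
  rewrite addnS big_ltn ?ltnS ?leq_addr// -addSn (le_trans (qnormD _ _))//.
  have : qn (g n) + qn (\sum_(n.+1 <= j < n.+1 + m) g j) <= 2 * r ^+ n.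
    rewrite mulrDl mul1r lerD ?gr// (le_trans (IH _))//.
    by rewrite exprS mulrA divff ?gt_eqF// mul1r.
  by rewrite /c -mulrA ler_pM2l// (lt_le_trans ltr01).
have rcvg : (fun n => c * r ^+ n) @ \oo --> (0 : R).
  by rewrite -(mulr0 c); apply: cvgMr; apply: cvg_expr; rewrite gtr0_norm.
apply: qnorm_complete => e e0.
have /cvgrPdist_lt/(_ _ e0)[N _ Nr] := rcvg.
exists N => m n; wlog mn : m n / (n <= m)%N => [hw Nm Nn|Nm Nn].
  have [mn|/ltnW nm] := leqP n m; first exact: hw.
  by rewrite qnorm_distC; exact: hw.
have -> : series g m - series g n = \sum_(n <= j < n + (m - n)) g j.
  by rewrite subnKC// /series/= (big_cat_nat (leq0n n) mn)/= addrAC subrr add0r.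
apply: le_lt_trans (tail _ _) _.
have := Nr n Nn; rewrite /= sub0r normrN => /(le_lt_trans _); apply.
exact: ler_norm.
Qed.

(* Gliding hump: bumps with disjoint supports, summable norms and projections
   of norm at least 1 add up to a vector whose expansion is not
   unconditionally Cauchy. *)
Lemma unconditional_complement_bound : unconditional x ->
  exists2 C, 1 <= C & complement_bound x xs C.
Proof.
move=> ux; have k1 := kappa_ge1 X.
have r0 j : 0 < (kappa X * 2)^-1 ^+ j.
  by rewrite exprn_gt0// invr_gt0 mulr_gt0// (lt_le_trans ltr01).
suff [L HL] : exists L : R, forall s f, uniq s -> qn (proj x xs s f) <= L * qn f.
  exists (kappa X * (1 + `|L|)) => [|s f us]; first by rewrite mulr_ege1// lerDl.
  rewrite (le_trans (qnormB _ _))// -mulrA ler_wpM2l ?kappa_ge0//.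
  rewrite mulrDl mul1r lerD2l (le_trans (HL s f us))//.
  by rewrite ler_wpM2r ?quasi_norm_ge0// ler_norm.
apply: contrapT => noL.
have /choice[b Hb] := fun p : nat * nat => unbounded_bump ux noL p.1 (r0 p.2).
(* Each bump starts where the previous one ends; the second argument of [b] sets its size. *)
pose N := fix N j := if j is i.+1 then (b (N i, i)).2 else 0%N.
pose g j := (b (N j, j)).1.1; pose S j := (b (N j, j)).1.2.
have HN j : [/\ uniq (S j), (N j < N j.+1)%N,
    forall n, n \in S j -> (N j <= n < N j.+1)%N,
    forall n, ~~ (N j <= n < N j.+1)%N -> xs n (g j) = 0 &
    qn (g j) <= (kappa X * 2)^-1 ^+ j /\ 1 <= qn (proj x xs (S j) (g j))].
  by rewrite /g /S /=; move: (Hb (N j, j)); case: (b _) => [[? ?] ?].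
have Nlt : {homo N : i j / (i < j)%N}.
  by apply: homo_ltn => [|j]; [exact: ltn_trans | case: (HN j)].
have Nle : {homo N : i j / (i <= j)%N} by exact: ltnW_homo.
have Nge j : (j <= N j)%N.
  by elim: j => // j IH; rewrite (leq_ltn_trans IH)//; case: (HN j).
have [f gf] : exists f, series g @ \oo --> f.
  by apply: geometric_series_cvg => j; have [_ _ _ _ []] := HN j.
(* The bumps have disjoint supports, so only [g j] contributes to the coordinates of [f] on
   [S j]. *)
have fS j n : n \in S j -> xs n f = xs n (g j).
  have [_ _ SN _ _] := HN j => /SN /andP[Nn nN].
  apply: (cvg_coef x_basis x_semi x_Mbdd gf (N := j.+1)) => m jm.
  rewrite /series/= big_mkord linear_sum (bigD1 (Ordinal jm))//= big1 ?addr0//.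
  move=> i; rewrite -(inj_eq val_inj)/= => ij; have [_ _ _ -> //] := HN i.
  rewrite negb_and -ltnNge -leqNgt.
  case: (ltngtP i j) ij => // lt _; apply/orP; [right|left].
    by rewrite (leq_trans _ Nn)// Nle.
  by rewrite (leq_trans nN)// Nle.
(* Tolerance 1 contradicts the lower bound 1 for the bump of index [M], as [S M] lies beyond
   [N M >= M]. *)
have [M SM] := unconditionally_sums_cauchy (unconditional_expansion (f := f) ux) ltr01.
have [uS _ SN _ [_ S1]] := HN M.
move: S1; apply/negP; rewrite -ltNge.
have -> : proj x xs (S M) (g M) = \sum_(n <- S M) xs n f *: x n.
  by apply: eq_big_seq => n nS; rewrite (fS M).
by apply: SM => // n /SN/andP[+ _]; exact: leq_trans.
Qed.

End UnconditionalBound.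

(** * Equivalence and comparison of the constants *)

Theorem theorem6p1 (R : realType) (k : scalar_kind) (X : quasiBanachType R k)
    (x : nat -> X) (xs : nat -> {scalar X})
    (x_basis : basis_with x xs) (x_semi : semi_normalized x)
    (x_Mbdd : M_bounded x xs) :
  [/\ greedy x xs <-> unconditional x /\ almost_greedy x xs,
      (C_ag x xs <= C_g x xs)%E,
      (C_g x xs <= C_ag x xs * K_su x)%E &
      continuous (quasi_norm : X -> R) -> (K_su x <= C_g x xs)%E].
Proof.
have HC := greedy_complement_bound x_basis x_semi x_Mbdd.
split.
- split=> [[C gC]|[ux [C agC]]].
    split; last by exists C; exact: (greedy_almost_greedy x_basis).
    exact: (complement_bound_unconditional x_basis x_semi x_Mbdd (HC C gC)).
  have [L L1 HL] := unconditional_complement_bound x_basis x_semi x_Mbdd ux.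
  by exists (C * L); exact: (almost_greedy_greedy x_basis).
- apply: le_ereal_inf_tmp => _ [C gC <-]; apply: ereal_inf_lbound.
  by exists C => //; exact: (greedy_almost_greedy x_basis).
- have Cag1 : (1 <= C_ag x xs)%E.
    by apply: le_ereal_inf_tmp => _ [C [C1 _] <-]; rewrite lee_fin.
  have K1 := K_su_ge1 x_basis.
  have [->|Koo] := eqVneq (K_su x) +oo%E.
    by rewrite gt0_muley ?leey// (lt_le_trans lte01).
  have Kfin : K_su x \is a fin_num.
    by rewrite ge0_fin_numE ?(le_trans lee01)// ltey.
  move: K1 Kfin; case KE : (K_su x) => [L| |]//; rewrite lee_fin => L1 _.
  have L0 : 0 < L by rewrite (lt_le_trans ltr01).
  rewrite -lee_pdivrMr//; apply: le_ereal_inf_tmp => _ [C agC <-].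
  (* The complement bound is obtained for constants strictly above [K_su], hence the slack [e]; with
     [L + e / C] the product is exactly [C * L + e]. *)
  rewrite lee_pdivrMr// -EFinM; apply/lee_addgt0Pr => e e0.
  have C0 : 0 < C by case: agC => C1 _; rewrite (lt_le_trans ltr01).
  have eC : 0 < e / C by rewrite divr_gt0.
  have -> : ((C * L)%:E + e%:E = (C * (L + e / C))%:E)%E.
    by rewrite -EFinD mulrDr mulrCA divff ?gt_eqF// mulr1.
  apply: ereal_inf_lbound; exists (C * (L + e / C)) => //.
  apply: (almost_greedy_greedy x_basis agC); first by rewrite (le_trans L1)// lerDl ltW.
  by apply: (K_su_complement_bound x_basis x_Mbdd); rewrite KE lte_fin ltrDl.
- move=> cqn; apply: le_ereal_inf_tmp => _ [C gC <-].
  apply: (complement_bound_K_su x_basis) (HC C gC) cqn.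
  by case: gC => C1 _; rewrite (le_trans ler01).
Qed.
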